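(* Let $0<q<1$, let $n\ge1$ be an integer, and let $a,d,\widehat c$ be fixed nonzero complex numbers with $ad\notin\{q^{-j}:0\le j\le n-1\}$. For $\Lambda>0$ put $b=\Lambda$ and $c=\widehat c/\Lambda$, and let $\Lambda\to\infty$. Then for every $0\le k,m\le n$ $$R_m\!\left(q^{-k}+\frac a\Lambda q^{k-n};\frac{ad}q,\frac{\widehat c}q,q^{-n-1},\frac a\Lambda\,\Big|\,q\right)\longrightarrow Q_m\!\left(q^{-k};\frac{ad}q,\frac{\widehat c}q,n\,\Big|\,q\right).$$ Moreover the prefactors $$\omega_{n,m}=a^{-m}(ab;q)_m(ac;q)_m(ad;q)_m,\qquad \pi_{n,k}=\frac{q^{k}}{\binom nk}\begin{bmatrix}n\\k\end{bmatrix}_q\frac{1-\frac ba q^{\,n-2k}}{(ab;q)_n\,(b/a;q)_{n-k}\,\bigl(1-\frac ba q^{\,n-k}\bigr)\,(\frac ab q;q)_k}$$ (with $b=\Lambda$, $c=\widehat c/\Lambda$) satisfy $$\lim_{\Lambda\to\infty}\Lambda^{-m}\omega_{n,m}=(-1)^mq^{\binom m2}(ad;q)_m,\qquad \lim_{\Lambda\to\infty}\Lambda^{2n-k}\pi_{n,k}=(-1)^ka^{-k}q^{-\binom n2-\binom{n-k}2}\,\frac{\begin{bmatrix}n\\k\end{bmatrix}_q}{\binom nk}.$$ Thus the polynomial part of the suitably normalised connection coefficients $\pi_{n,k}\,\omega_{n,m}\,R_m$ degenerates from $q$-Racah to $q$-Hahn on the lattice $q^{-k}$.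
   Context: Notation: $(c;q)_k=\prod_{j=0}^{k-1}(1-cq^j)$, $(c_1,\dots,c_r;q)_k=\prod_i(c_i;q)_k$, $\begin{bmatrix}n\\k\end{bmatrix}_q=\frac{(q;q)_n}{(q;q)_k(q;q)_{n-k}}$. The $q$-Racah polynomials are $$R_m(q^{-k}+\gamma\delta q^{k+1};\alpha,\beta,\gamma,\delta\,|\,q)=\sum_{j=0}^{\min(m,k)}\frac{(q^{-m},\alpha\beta q^{m+1},q^{-k},\gamma\delta q^{k+1};q)_j}{(q,\alpha q,\beta\delta q,\gamma q;q)_j}\,q^j,$$ and the $q$-Hahn polynomials are normalised as $$Q_m(q^{-k};\alpha',\beta',n\,|\,q)=\sum_{j=0}^{\min(m,k)}\frac{(q^{-m},\alpha'\beta'q^{m+1},q^{-k};q)_j}{(q,\alpha'q,q^{-n};q)_j}\,q^j .$$ *)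

(* Defs.v *)
From mathcomp Require Import all_boot all_order all_algebra.
From mathcomp Require Import complex.

Set Implicit Arguments.
Unset Strict Implicit.
Unset Printing Implicit Defensive.

Import Order.TTheory GRing.Theory Num.Theory.
Local Open Scope ring_scope.

Section QSeries.
Variable F : fieldType.
Implicit Types (q c x : F) (n m k : nat).

Definition qpoch q c k : F := \prod_(j < k) (1 - c * q ^+ j).

Definition qpochs q (cs : seq F) k : F := \prod_(c <- cs) qpoch q c k.

Definition qbinom q n k : F :=
  qpoch q q n / (qpoch q q k * qpoch q q (n - k)).

(* [qRacah q m k al be ga de] is R_m(x; al, be, ga, de | q) at the lattice
   point x = q^-k + ga de q^(k+1); the lattice point is given by its index k.
   The sum runs over j <= min(m, k). *)
Definition qRacah q m k (al be ga de : F) : F :=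
  \sum_(j < (minn m k).+1)
    qpochs q [:: q ^- m; al * be * q ^+ m.+1; q ^- k; ga * de * q ^+ k.+1] j
    / qpochs q [:: q; al * q; be * de * q; ga * q] j * q ^+ j.

(* [qHahn q m k al be n] is Q_m(q^-k; al, be, n | q). *)
Definition qHahn q m k (al be : F) n : F :=
  \sum_(j < (minn m k).+1)
    qpochs q [:: q ^- m; al * be * q ^+ m.+1; q ^- k] j
    / qpochs q [:: q; al * q; q ^- n] j * q ^+ j.

(* omega_{n,m}: the formula does not involve n. *)
Definition omega q (a b c d : F) m : F :=
  a ^- m * qpoch q (a * b) m * qpoch q (a * c) m * qpoch q (a * d) m.

(* pi_{n,k}, for k <= n; the exponent n - 2k may be negative, so it is taken
   in int. *)
Definition piw q (a b : F) n k : F :=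
  q ^+ k / 'C(n, k)%:R * qbinom q n k
  * ((1 - b / a * q ^ (n%:Z - (2 * k)%:Z))
     / (qpoch q (a * b) n * qpoch q (b / a) (n - k)
        * (1 - b / a * q ^+ (n - k)) * qpoch q (a / b * q) k)).

(* For ga = q^(-n-1) and de = e the lattice point of [qRacah] is
   q^-k + e q^(k-n). *)
Lemma qRacah_lattice q (e : F) n k : q != 0 ->
  q ^- k + q ^- n.+1 * e * q ^+ k.+1 = q ^- k + e * q ^ (k%:Z - n%:Z).
Proof.
move=> q0; congr (_ + _); rewrite mulrAC mulrC; congr (_ * _).
have -> : k%:Z - n%:Z = - n.+1%:Z + k.+1%:Z.
  by rewrite !intS opprD addrACA addNr add0r addrC.
by rewrite expfzDr // exprnN.
Qed.

End QSeries.

(* Main.v *)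
(** Everything is a rational function of 1/L, so it suffices to let 1/L tend to
    0. A q-shifted factorial (c L; q)_n is of order L^n, and
    L^-n (c L; q)_n = \prod_(j < n) (1/L - c q^j) tends to
    (- c)^n q^(n(n-1)/2). The factor of order n + (n - k) in the denominator of
    pi thus absorbs L^(2n - k), while its two remaining linear factors in L
    compensate each other. In R_m only the factors (ga de q^(k+1); q)_j and
    (be de q; q)_j depend on L, and both tend to 1. *)

Require Import Defs.
From mathcomp Require Import all_boot all_order all_algebra.
From mathcomp Require Import all_classical all_reals all_analysis.
From mathcomp Require Import complex ring zify.
Import Order.TTheory GRing.Theory Num.Theory.
Import numFieldNormedType.Exports.
Local Open Scope classical_set_scope.
Local Open Scope ring_scope.
Local Open Scope complex_scope.

Section QLimits.
Context {K : numFieldType} {T : Type} {F : set_system T} {FF : Filter F}.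
Implicit Types (q a c l : K) (f L : T -> K) (n m k j : nat).

Lemma cvg_qpoch q f l n :
  f x @[x --> F] --> l -> qpoch q (f x) n @[x --> F] --> qpoch q l n.
Proof.
move=> fl; apply: cvg_big => [|i _]; first exact: mul_continuous.
by apply: cvgB; [exact: cvg_cst|exact: cvgMr_tmp].
Qed.

Lemma qpoch0 q n : qpoch q 0 n = 1.
Proof. by rewrite /qpoch big1 // => i _; rewrite mul0r subr0. Qed.

Lemma cvg_qpoch0 q f n :
  f x @[x --> F] --> (0 : K) -> qpoch q (f x) n @[x --> F] --> (1 : K).
Proof. by rewrite -(qpoch0 q n); exact: cvg_qpoch. Qed.

Lemma scaled_qpochE q c l n : l != 0 ->
  l ^- n * qpoch q (c * l) n = \prod_(j < n) (l^-1 - c * q ^+ j).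
Proof.
move=> l0; rewrite -exprVn -[in l^-1 ^+ n](card_ord n) -prodr_const -big_split.
by apply: eq_bigr => j _ /=; field.
Qed.

(** The exponents 0, ..., n - 1 add up to ['C(n, 2)]. The unsimplified [0 - c * q ^+ j] is the form
    in which the limit of [l^-1 - c * q ^+ j] arises as [l^-1] tends to 0. *)
Lemma prod_oppM_expr q c n :
  \prod_(j < n) (0 - c * q ^+ j) = (- c) ^+ n * q ^+ 'C(n, 2).
Proof.
rewrite -bin2_sum big_mkord -prodrXr -[in LHS](card_ord n).
rewrite -[in (- c) ^+ n](card_ord n) -prodr_const -big_split card_ord.
by apply: eq_bigr => j _ /=; rewrite sub0r mulNr.
Qed.

Section Infinity.
(** All that is retained of the parameter tending to infinity: it is eventually invertible and its
    inverse tends to 0. The theorem takes for [L] the embedding of the reals into [R[i]]. *)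
Context {L : T -> K}.
Hypothesis L_neq0 : \forall x \near F, L x != 0.
Hypothesis cvgLV : (L x)^-1 @[x --> F] --> (0 : K).

Lemma cvg_divL0 c : c / L x @[x --> F] --> (0 : K).
Proof. by rewrite -(mulr0 c); exact: cvgMl_tmp. Qed.

Lemma cvg_scaled_qpoch q c n :
  (L x) ^- n * qpoch q (c * L x) n @[x --> F] --> (- c) ^+ n * q ^+ 'C(n, 2).
Proof.
rewrite -prod_oppM_expr.
apply: (@cvg_trans _ (\prod_(j < n) ((L x)^-1 - c * q ^+ j) @[x --> F])).
  by apply: near_eq_cvg; near=> x; rewrite scaled_qpochE //; near: x.
apply: cvg_big => [|i _]; first exact: mul_continuous.
by apply: cvgB; [exact: cvgLV|exact: cvg_cst].
Unshelve. all: by end_near. Qed.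

Lemma cvg_scaled_1B c :
  (L x)^-1 * (1 - L x * c) @[x --> F] --> - c.
Proof.
rewrite -[- c]add0r.
apply: (@cvg_trans _ ((L x)^-1 - c @[x --> F])).
  apply: near_eq_cvg; near=> x.
  by rewrite mulrBr mulr1 mulKf //; near: x.
by apply: cvgB; [exact: cvgLV|exact: cvg_cst].
Unshelve. all: by end_near. Qed.

Lemma cvg_qRacah q m k al be n a : q != 0 ->
  qRacah q m k al be (q ^- n.+1) (a / L x) @[x --> F] --> qHahn q m k al be n.
Proof.
move=> q0; apply: cvg_big => [|i _]; first exact: add_continuous.
(* This turns the parameter [ga * q] into the [q ^- n] of the q-Hahn denominator. *)
have gaE : q ^- n.+1 * q = q ^- n by rewrite exprSr invfM mulfVK.
apply: cvgMr_tmp.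
set A := qpoch q (q ^- m) i; set B := qpoch q (al * be * q ^+ m.+1) i.
set C := qpoch q (q ^- k) i; set D := qpoch q q i.
set E := qpoch q (al * q) i; set G := qpoch q (q ^- n) i.
have termE x : qpochs q [:: q ^- m; al * be * q ^+ m.+1; q ^- k;
        q ^- n.+1 * (a / L x) * q ^+ k.+1] i
      / qpochs q [:: q; al * q; be * (a / L x) * q; q ^- n.+1 * q] i =
    qpoch q (q ^- n.+1 * (a / L x) * q ^+ k.+1) i /
      qpoch q (be * (a / L x) * q) i * (A * B * C / (D * E * G)).
  by rewrite /qpochs !unlock /= gaE -/A -/B -/C -/D -/E -/G mulf_div;
     congr (_ / _); ring.
under eq_fun do rewrite termE.
have -> : qpochs q [:: q ^- m; al * be * q ^+ m.+1; q ^- k] i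
      / qpochs q [:: q; al * q; q ^- n] i = 1 / 1 * (A * B * C / (D * E * G)).
  by rewrite /qpochs !unlock /= divr1 mul1r !mulr1 !mulrA.
apply: cvgMr_tmp; apply: cvgM; last first.
  apply: cvgV; first exact: oner_neq0.
  apply: cvg_qpoch0.
  rewrite -(mul0r q); apply: cvgMr_tmp; rewrite -(mulr0 be).
  by apply: cvgMl_tmp; exact: cvg_divL0.
apply: cvg_qpoch0.
rewrite -(mul0r (q ^+ k.+1)); apply: cvgMr_tmp.
rewrite -(mulr0 (q ^- n.+1)).
by apply: cvgMl_tmp; exact: cvg_divL0.
Qed.

Lemma cvg_omega q a c d m : a != 0 ->
  (L x) ^- m * omega q a (L x) (c / L x) d m @[x --> F] -->
  (-1) ^+ m * q ^+ 'C(m, 2) * qpoch q (a * d) m.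
Proof.
move=> a0; rewrite /omega.
have -> : (-1) ^+ m * q ^+ 'C(m, 2) * qpoch q (a * d) m =
    a ^- m * ((- a) ^+ m * q ^+ 'C(m, 2)) * 1 * qpoch q (a * d) m.
  by rewrite [(- a) ^+ m]exprNn; field; exact: expf_neq0.
have -> : (fun x => (L x) ^- m *
    (a ^- m * qpoch q (a * L x) m * qpoch q (a * (c / L x)) m *
     qpoch q (a * d) m)) =
    (fun x => a ^- m * ((L x) ^- m * qpoch q (a * L x) m) *
     qpoch q (a * (c / L x)) m * qpoch q (a * d) m).
  by apply/funext => x; ring.
(* Only the factor with [a * L x] grows, and it has absorbed [(L x) ^- m]; the one with
   [a * (c / L x)] tends to 1. *)
apply: cvgMr_tmp; apply: cvgM.
  by apply: cvgMl_tmp; exact: cvg_scaled_qpoch.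
rewrite -(qpoch0 q m); apply: cvg_qpoch.
by rewrite -(mulr0 a); apply: cvgMl_tmp; exact: cvg_divL0.
Qed.

Lemma cvg_piw q a n k : q != 0 -> a != 0 -> (k <= n)%N ->
  (L x) ^+ (2 * n - k) * piw q a (L x) n k @[x --> F] -->
  (-1) ^+ k * a ^- k * q ^ (- 'C(n, 2)%:Z - 'C(n - k, 2)%:Z)
  * (qbinom q n k / 'C(n, k)%:R).
Proof.
move=> q0 a0 kn; set e := (n%:Z - (2 * k)%:Z).
(* The coefficients of [L x] in the two linear factors; [P1] and [P2] are the limits of the two
   rescaled growing q-shifted factorials. *)
set u := a^-1 * q ^ e; set v := a^-1 * q ^+ (n - k).
set P1 := (- a) ^+ n * q ^+ 'C(n, 2).
set P2 := (- a^-1) ^+ (n - k) * q ^+ 'C(n - k, 2).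
have P1_neq0 : P1 != 0 by rewrite mulf_neq0 ?expf_neq0 ?oppr_eq0.
have P2_neq0 : P2 != 0 by rewrite mulf_neq0 ?expf_neq0 ?oppr_eq0 ?invr_eq0.
have u_neq0 : u != 0 by rewrite mulf_neq0 ?expfz_neq0 ?invr_eq0.
have vE : u * q ^+ k = v.
  rewrite -mulrA -[q ^+ k]/(q ^ k%:Z) -expfzDr //.
  by have -> : e + k%:Z = (n - k)%N by lia.
have v_neq0 : v != 0 by rewrite mulf_neq0 ?expf_neq0 ?invr_eq0.
have -> : (-1) ^+ k * a ^- k * q ^ (- 'C(n, 2)%:Z - 'C(n - k, 2)%:Z)
      * (qbinom q n k / 'C(n, k)%:R) =
    q ^+ k / 'C(n, k)%:R * qbinom q n k * (- u / (P1 * P2 * - v * 1)).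
  (* Since [u / v = q ^- k], the linear factors cancel the prefactor [q ^+ k] in the limit. *)
  have -> : - u / (P1 * P2 * - v * 1) = q ^- k / (P1 * P2).
    rewrite -vE; field.
    by rewrite P1_neq0 P2_neq0 u_neq0 expf_neq0.
  (* Of the [n] factors [- a], [n - k] cancel against the factors [- a^-1]. *)
  have -> : P1 * P2 = (- a) ^+ k * (q ^+ 'C(n, 2) * q ^+ 'C(n - k, 2)).
    rewrite /P1 /P2 mulrACA -[in (- a) ^+ n](subnK kn) exprD.
    rewrite [_ * (- a^-1) ^+ _]mulrAC.
    by rewrite -exprMn mulrNN mulfV // expr1n mul1r.
  have -> : q ^ (- 'C(n, 2)%:Z - 'C(n - k, 2)%:Z) =
      (q ^+ 'C(n, 2) * q ^+ 'C(n - k, 2))^-1.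
    by rewrite -opprD -PoszD -exprnN exprD.
  rewrite [(- a) ^+ k]exprNn [in RHS]invfM [in RHS]invfM invr_sign.
  set X := (_ * _)^-1; set Y := 'C(n, k)%:R^-1.
  by field; rewrite !expf_neq0.
apply: (@cvg_trans _ (q ^+ k / 'C(n, k)%:R * qbinom q n k *
  ((L x)^-1 * (1 - L x * u) /
    ((L x) ^- n * qpoch q (a * L x) n *
     ((L x) ^- (n - k) * qpoch q (a^-1 * L x) (n - k)) *
     ((L x)^-1 * (1 - L x * v)) * qpoch q (a / L x * q) k)) @[x --> F])).
  apply: near_eq_cvg; near=> x.
  have Lx : L x != 0 by near: x.
  rewrite /piw -/e [L x / a]mulrC; set A1 := qpoch q (a * _) n.
  rewrite -[_ * L x * _]mulrAC -/u -[_ * L x * _]mulrAC -/v ![_ * L x]mulrC.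
  rewrite [a / L x * q]mulrAC.
  (* The subtractions are truncated, so this splitting of the power of [L x] rests on [k <= n]. *)
  have -> : (2 * n - k = n + (n - k))%N by lia.
  set A2 := qpoch q _ (n - k); set V := 1 - _ * v; set W := qpoch _ _ k.
  rewrite exprD !invfM !invrK.
  (* With the inverses made opaque, [field] has no side condition on these denominators, which may
     vanish at particular values of [L x]. *)
  move: (A1^-1) (A2^-1) (V^-1) (W^-1) ('C(n, k)%:R^-1) => A1' A2' V' W' C'.
  by field.
apply: cvgMl_tmp; apply: cvgM; first exact: cvg_scaled_1B.
apply: cvgV; first by rewrite mulr1 mulf_neq0 ?oppr_eq0 // mulf_neq0.
apply: cvgM.
  apply: cvgM; last exact: cvg_scaled_1B.
  by apply: cvgM; exact: cvg_scaled_qpoch.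
rewrite -(qpoch0 q k); apply: cvg_qpoch.
by rewrite -(mul0r q); apply: cvgMr_tmp; exact: cvg_divL0.
Unshelve. all: by end_near. Qed.

End Infinity.
End QLimits.

Lemma cvg_real_complexV (R : realType) :
  ((L%:C)^-1 : R[i]^o) @[L --> +oo] --> (0 : R[i]^o).
Proof.
(* A positive element of [R[i]] has zero imaginary part, so the bound becomes the real inequality
   [e^-1 < L]. *)
apply/cvgr0Pnorm_lt => -[e e'] /[!ltcE] /andP[/= /eqP -> e0].
near=> L.
have L0 : 0 < L by near: L; exact: nbhs_pinfty_gt.
rewrite -fmorphV normc_def /= expr0n addr0 sqrtr_sqr ltcE /= eqxx /=.
rewrite gtr0_norm ?invr_gt0 // -[e]invrK ltf_pV2 ?posrE ?invr_gt0 //.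
by near: L; apply: nbhs_pinfty_gt; rewrite num_real.
Unshelve. all: by end_near. Qed.

Theorem proposition6p2 (R : realType) (q : R) (n : nat) (a d chat : R[i])
    (q_gt0 : 0 < q) (q_lt1 : q < 1) (n_ge1 : (1 <= n)%N)
    (a_neq0 : a != 0) (d_neq0 : d != 0) (chat_neq0 : chat != 0)
    (ad_gen : forall j : nat, (j <= n - 1)%N -> a * d <> q%:C ^- j) :
  forall k m : nat, (k <= n)%N -> (m <= n)%N ->
  let Q : R[i] := q%:C in
  let RL (L : R) : R[i] :=
    qRacah Q m k (a * d / Q) (chat / Q) (Q ^- n.+1) (a / L%:C) in
  let omegaL (L : R) : R[i] := omega Q a L%:C (chat / L%:C) d m in
  let piL (L : R) : R[i] := piw Q a L%:C n k in
  let Rlim : R[i] := qHahn Q m k (a * d / Q) (chat / Q) n in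
  let omegalim : R[i] := (-1) ^+ m * Q ^+ 'C(m, 2) * qpoch Q (a * d) m in
  let pilim : R[i] :=
    (-1) ^+ k * a ^- k * Q ^ (- 'C(n, 2)%:Z - 'C(n - k, 2)%:Z)
    * (qbinom Q n k / 'C(n, k)%:R) in
  [/\ (fun L : R => RL L : R[i]^o) @ +oo --> (Rlim : R[i]^o),
      (fun L : R => L%:C ^- m * omegaL L : R[i]^o) @ +oo
        --> (omegalim : R[i]^o),
      (fun L : R => L%:C ^+ (2 * n - k) * piL L : R[i]^o) @ +oo
        --> (pilim : R[i]^o)
    & (fun L : R => (L%:C ^+ (2 * n - k) * piL L) * (L%:C ^- m * omegaL L)
                    * RL L : R[i]^o) @ +oo
        --> (pilim * omegalim * Rlim : R[i]^o)].
Proof.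
have Q0 : (q%:C : R[i]) != 0 by rewrite fmorph_eq0 gt_eqF.
have L0 : \forall L \near +oo, (L%:C : R[i]) != 0.
  by near=> L; rewrite fmorph_eq0 gt_eqF //; near: L; exact: nbhs_pinfty_gt.
have LV := cvg_real_complexV R.
move=> k m kn mn Q RL omegaL piL Rlim omegalim pilim.
have cvgR : (fun L => RL L : R[i]^o) @ +oo --> (Rlim : R[i]^o).
  exact: (cvg_qRacah LV).
have cvgo : (fun L => L%:C ^- m * omegaL L : R[i]^o) @ +oo
    --> (omegalim : R[i]^o).
  exact: (cvg_omega L0 LV).
have cvgp : (fun L => L%:C ^+ (2 * n - k) * piL L : R[i]^o) @ +oo
    --> (pilim : R[i]^o).
  exact: (cvg_piw L0 LV).
split; [exact: cvgR|exact: cvgo|exact: cvgp|].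
exact: (cvgM (cvgM cvgp cvgo) cvgR).
Unshelve. all: by end_near. Qed.
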